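(* Let $x_0\in[a,b]$, $y_0\in\mathbb{R}$, and consider the multiplicative initial-value problem $$y^*=f(x,y),\qquad y(x_0)=y_0,$$ where $f$ is one time $*$-differentiable on $(a,b)$, having the exact solution $y(x)$. Let $h_0>0$ and $\gamma>1$ (the value $\gamma=\infty$ being allowed), and let the function $\Phi=\Phi(x,y;h)$ defining a multiplicative one-step method be continuous on $$G:=\left\{(x,y,h)\ \middle|\ a\le x\le b,\ \left|\frac{y}{y(x)}\right|\le\gamma,\ 0\le|h|\le h_0\right\}.$$ Suppose there exist positive constants $M$ and $N$ such that $$\left|\frac{\Phi(x,y_1;h)}{\Phi(x,y_2;h)}\right|\le\left|\frac{y_1}{y_2}\right|^M$$ for all $(x,y_i,h)\in G$, $i=1,2$, and $$|\tau(x,y(x);h)|=\left|\frac{\Delta(x,y(x);h)}{\Phi(x,y(x);h)}\right|\le e^{N|h|^p},\qquad p>0,$$ for all $x\in[a,b]$, $|h|\le h_0$. Then there exists an $\overline{h}$ with $0<\overline{h}\le h_0$ such that the multiplicative global discretization error $e(x;h)=\frac{\eta(x;h)}{y(x)}$ satisfies $$|e(x;h_n)|\le \exp\left(|h_n|^p\,N\,\frac{e^{M|x-x_0|}-1}{M}\right)$$ for all $x\in[a,b]$ and all $h_n=\frac{x-x_0}{n}$, $n=1,2,\dots$, with $|h_n|\le\overline{h}$. If $\gamma=\infty$, then one may take $\overline{h}=h_0$.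
   Context: Geometric multiplicative calculus: the multiplicative derivative ($*$-derivative) of a function $y$ of a real variable is $y^*(x)=\lim_{h\to0}\left(\frac{y(x+h)}{y(x)}\right)^{1/h}=\exp\left(\frac{y'(x)}{y(x)}\right)$, defined where $y$ is nonzero and differentiable; ''$*$-differentiable'' means that this derivative exists. One-step method: a function $\Phi(x,y;h)$ defines the multiplicative one-step method $$\eta_0:=y_0,\qquad \eta_{i+1}:=\eta_i\,\Phi(x_i,\eta_i;h)^h,\qquad x_{i+1}:=x_i+h,\qquad i=0,1,2,\dots$$ It produces the approximate solution $\eta(x;h):=\eta_i$ if $x=x_0+ih$. In particular, for $h=h_n=\frac{x-x_0}{n}$ one has $\eta(x;h_n)=\eta_n$. The multiplicative global discretization error is $e(x;h):=\frac{\eta(x;h)}{y(x)}$, where $y(x)$ is the exact solution of the initial-value problem. Multiplicative ratio function: for fixed $x,y$, let $z(t)$ be the exact solution of $z^*(t)=f(t,z(t))$, $z(x)=y$. Then $$\Delta(x,y;h):=\begin{cases}\left(\frac{z(x+h)}{y}\right)^{1/h}& \text{if } h\ne0,\\ f(x,y)&\text{if } h=0.\end{cases}$$ The multiplicative local discretization error at $(x,y)$ is $\tau(x,y;h):=\frac{\Delta(x,y;h)}{\Phi(x,y;h)}$.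
   Formalization: |r| of a quotient is read as the multiplicative absolute value max(|r|,1/|r|), so τ is bounded above and below; with the ordinary |·| the claim fails (f=1, y=1, Φ=2|y|). Also Φ>0 and y≠0 are required on G. *)

(* Defs.v *)
From HB Require Import structures.
From mathcomp Require Import all_boot all_order all_algebra.
From mathcomp Require Import all_classical all_reals all_analysis.

Set Implicit Arguments.
Unset Strict Implicit.
Unset Printing Implicit Defensive.

Import Order.TTheory GRing.Theory Num.Theory.
Import numFieldNormedType.Exports.

Local Open Scope classical_set_scope.
Local Open Scope ring_scope.

Section GeometricMultiplicativeCalculus.
Variable R : realType.
Implicit Types (y z : R -> R) (f : R -> R -> R) (Phi : R -> R -> R -> R).

(* The multiplicative absolute value, exp |ln r| for r > 0, extended to
   nonzero reals by evenness. It is the reading of |.| for every quotient below.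
   With the ordinary absolute value, the growth condition
   |Phi(x,y1;h) / Phi(x,y2;h)| <= |y1 / y2|^M applied to (y1, y2) and to
   (y2, y1) would force equality, and an upper bound on
   |tau| = |Delta / Phi| would leave Phi, hence eta, unbounded from above.
   Pitfall: mabs 0 = 0, so it is only meaningful at nonzero arguments. *)
Definition mabs (r : R) : R := Num.max `|r| `|r|^-1.

(* Nonvanishing and differentiability are explicit: powR sends negative
   bases to 1, so the limit alone could exist for discontinuous y. *)
Definition is_mderive y (x l : R) : Prop :=
  [/\ y x != 0, derivable y x 1 &
      (fun h => (y (x + h) / y x) `^ h^-1) @ 0^' --> l].

Definition mderivable y (x : R) : Prop := exists l, is_mderive y x l.

(* f has both partial *-derivatives; y = 0 is excluded because a function
   taking the value 0 has no *-derivative there, so the equation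
   y^* = f(x, y) never involves f(x, 0). *)
Definition mdifferentiable2 f (a b : R) : Prop :=
  forall x y : R, a < x < b -> y != 0 ->
    mderivable (fun t => f t y) x /\ mderivable (f x) y.

Definition is_msolution f (a b x0 y0 : R) y : Prop :=
  [/\ y x0 = y0,
      {within `[a, b], continuous y},
      (forall t, a <= t <= b -> y t != 0) &
      (forall t, a < t < b -> is_mderive y t (f t (y t)))].

(* z stands for the exact solution through (x, y). *)
Definition mratio f z (x y h : R) : R :=
  if h == 0 then f x y else (z (x + h) / y) `^ h^-1.

Definition local_error f Phi z (x y h : R) : R :=
  mratio f z x y h / Phi x y h.

Fixpoint grid (x0 h : R) (i : nat) : R :=
  if i is j.+1 then grid x0 h j + h else x0.

Fixpoint eta Phi (x0 y0 h : R) (i : nat) : R :=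
  if i is j.+1 then
    eta Phi x0 y0 h j * Phi (grid x0 h j) (eta Phi x0 y0 h j) h `^ h
  else y0.

Definition stepsize (x0 x : R) (n : nat) : R := (x - x0) / n%:R.

(* e(x; h_n), using eta(x; h_n) = eta_n for h_n = (x - x0) / n. *)
Definition global_error Phi y (x0 y0 x : R) (n : nat) : R :=
  eta Phi x0 y0 (stepsize x0 x n) n / y x.

(* The set G, with points (x, y, h) encoded as ((x, y), h). *)
Definition Gdomain y (a b : R) (gamma : \bar R) (h0 : R) : set (R * R * R) :=
  [set q | [/\ a <= q.1.1 <= b, q.1.2 != 0,
               ((mabs (q.1.2 / y q.1.1))%:E <= gamma)%E & `|q.2| <= h0]].

Definition global_error_bound Phi y (a b x0 y0 M N p hbar : R) : Prop :=
  forall (x : R) (n : nat), a <= x <= b -> (0 < n)%N ->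
    `|stepsize x0 x n| <= hbar ->
    mabs (global_error Phi y x0 y0 x n) <=
      expR (`|stepsize x0 x n| `^ p * N * ((expR (M * `|x - x0|) - 1) / M)).

End GeometricMultiplicativeCalculus.

(* Main.v *)
Require Import Defs.
From HB Require Import structures.
From mathcomp Require Import all_boot all_order all_algebra.
From mathcomp Require Import all_classical all_reals all_analysis.
From mathcomp Require Import ring lra.

Set Implicit Arguments.
Unset Strict Implicit.
Unset Printing Implicit Defensive.

Import Order.TTheory GRing.Theory Num.Theory.
Import numFieldNormedType.Exports.

Local Open Scope classical_set_scope.
Local Open Scope ring_scope.

(* Since y never vanishes on [a, b], it is itself an exact solution through
   (x, y x), so tau bounds the consistency error along y. In logarithmic form,
   d_i = |ln (eta_i / y x_i)| satisfies the additive recursion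
   d_(i+1) <= (1 + M |h|) d_i + N |h|^p |h|, whence
   d_i <= N |h|^p (e^(M i |h|) - 1) / M. The step is legitimate as long as
   d_i <= ln gamma, which this same bound guarantees for small |h|. *)

Section OneStep.
Variable R : realType.
Implicit Types (r s t x h M : R).

(** The sign of [ln r] decides which of [r] and [r^-1] is the larger. This identity turns every
    multiplicative estimate below into an additive one. *)
Lemma mabsE r : 0 < r -> mabs r = expR `|ln r|.
Proof.
move=> r0; rewrite /mabs (gtr0_norm r0).
have [r1|/ltW r1] := leP 1 r.
  rewrite ger0_norm ?ln_ge0// lnK ?posrE//; apply/max_idPl.
  by rewrite (le_trans _ r1)// invf_le1.
rewrite ler0_norm ?ln_le0// -lnV ?posrE// lnK ?posrE ?invr_gt0//; apply/max_idPr.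
by rewrite (le_trans r1)// invf_ge1.
Qed.

Lemma mabs_le_expR r s : 0 < r -> (mabs r <= expR s) = (`|ln r| <= s).
Proof. by move=> r0; rewrite mabsE// ler_expR. Qed.

(** A sign change would produce a zero by the intermediate value theorem. Positivity of these
    quotients is what gives their logarithms meaning. *)
Lemma same_sign_of_continuous_neq0 (a b : R) (y : R -> R) :
  {within `[a, b], continuous y} -> (forall t, a <= t <= b -> y t != 0) ->
  forall s t, a <= s <= b -> a <= t <= b -> 0 < y t / y s.
Proof.
move=> yc y0.
(* The product is symmetric in [s] and [t], so one may assume [s <= t]. *)
suff H s t : a <= s -> s <= t -> t <= b -> 0 < y s * y t.
  move=> s t /[dup] sab /andP[as_ sb] /andP[at_ tb].
  have ys2 : 0 < y s ^+ 2 by rewrite exprn_even_gt0//= y0.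
  have -> : y t / y s = y s * y t / y s ^+ 2 by field; rewrite y0.
  rewrite divr_gt0//.
  by have [/H|/ltW /H] := leP s t; [|rewrite mulrC]; exact.
move=> as_ st tb; rewrite ltNge; apply/negP => yst.
have yc' : {within `[s, t], continuous y}.
  apply: continuous_subspaceW yc => z /=; rewrite !in_itv/= => /andP[sz zt].
  by rewrite (le_trans as_ sz) (le_trans zt tb).
have [||c] := @IVT R y s t 0 _ yc'; first by [].
  rewrite ge_min le_max.
  case: (ltgtP (y s) 0) yst => [ys|ys|->] //=.
    by rewrite nmulr_rle0.
  by rewrite pmulr_rle0// => ->.
rewrite in_itv/= => /andP[sc ct] yc0.
by have := y0 c; rewrite yc0 eqxx (le_trans as_ sc) (le_trans ct tb) => /(_ isT).
Qed.

Lemma gridE x h i : grid x h i = x + i%:R * h.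
Proof.
by elim: i => [|i IH] /=; rewrite ?mul0r ?addr0// IH -natr1 mulrDl mul1r addrA.
Qed.

Lemma grid_itv (a b x0 x : R) n i : a <= x0 <= b -> a <= x <= b ->
  (0 < n)%N -> (i <= n)%N -> a <= grid x0 (stepsize x0 x n) i <= b.
Proof.
move=> /andP[ax0 x0b] /andP[ax xb] n0 lein; rewrite gridE /stepsize.
have n0' : 0 < n%:R :> R by rewrite ltr0n.
have t0 : 0 <= i%:R / n%:R :> R by rewrite divr_ge0.
have t1 : i%:R / n%:R <= 1 :> R by rewrite ler_pdivrMr// mul1r ler_nat.
(* The grid point is the convex combination of [x0] and [x] with weight [t] on [x]; this also covers
   [x < x0]. *)
rewrite mulrCA; set t := i%:R / n%:R in t0 t1 *.
by apply/andP; split; nra.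
Qed.

(** Here [v], [v'] are consecutive exact values, [u] is the approximation to [v], and [P], [Q] are
    the values of [Phi] at [u] and [v]. Inserting [Q] splits the new logarithmic error into the old
    one, a growth term and a local error term. *)
Lemma one_step_log_error (u v v' P Q h M B : R) :
  0 < u / v -> 0 < v' / v -> 0 < P -> 0 < Q ->
  `|ln (P / Q)| <= M * `|ln (u / v)| ->
  (h != 0 -> `|ln ((v' / v) `^ h^-1 / Q)| <= B) ->
  (h = 0 -> v' = v) ->
  0 < u * P `^ h / v' /\
  `|ln (u * P `^ h / v')| <= (1 + M * `|h|) * `|ln (u / v)| + B * `|h|.
Proof.
move=> uv v'v P0 Q0 growth loc h0v.
have v0 : v != 0 by apply: contraTneq v'v => ->; rewrite invr0 mulr0 ltxx.
have v'0 : v' != 0 by apply: contraTneq v'v => ->; rewrite mul0r ltxx.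
have Ph : 0 < P `^ h by exact: powR_gt0.
have E : u * P `^ h / v' = (u / v) * P `^ h / (v' / v).
  by field; rewrite v0 v'0.
have u'0 : 0 < u * P `^ h / v'.
  by rewrite E; apply: divr_gt0 => //; apply: mulr_gt0.
split=> //.
(* For [h = 0] the exponent [h^-1] is 0 and cannot be cancelled, but nothing moves. *)
have [h0|h0] := eqVneq h 0.
  by rewrite h0v// h0 powRr0 mulr1 normr0 !mulr0 !addr0 mul1r.
have {}loc := loc h0.
have lnE : ln (u * P `^ h / v') =
    ln (u / v) + h * ln (P / Q) - h * ln ((v' / v) `^ h^-1 / Q).
  have uvPh : 0 < u / v * P `^ h by exact: mulr_gt0.
  rewrite E [LHS]ln_div ?posrE// [ln (_ * P `^ h)]lnM ?posrE//.
  by rewrite [ln (P / Q)]ln_div ?posrE// [ln (_ / Q)]ln_div ?posrE ?powR_gt0//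
    !ln_powR; field.
rewrite lnE (le_trans (ler_normB _ _))// !normrM.
rewrite (le_trans (lerD (ler_normD _ _) (lexx _)))// normrM.
have := ler_wpM2l (normr_ge0 h) growth.
have := ler_wpM2l (normr_ge0 h) loc.
by lra.
Qed.

(** With [1 + M * k] in place of [expR (M * k)] the bound would satisfy the recursion with equality;
    the only loss is [1 + M * k <= expR (M * k)]. *)
Lemma discrete_gronwall_step (M k B d : R) (i : nat) :
  0 < M -> 0 <= k -> 0 <= B ->
  d <= B * ((expR (M * (i%:R * k)) - 1) / M) ->
  (1 + M * k) * d + B * k <= B * ((expR (M * (i.+1%:R * k)) - 1) / M).
Proof.
move=> M0 k0 B0 dle.
have Mk0 : 0 <= M * k by rewrite mulr_ge0// ltW.
have -> : expR (M * (i.+1%:R * k)) = expR (M * (i%:R * k)) * expR (M * k).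
  by rewrite -expRD -natr1; congr expR; ring.
have e1 := expR_ge1Dx (M * k).
set E := expR (M * (i%:R * k)) in dle *.
have E0 : 0 < E by exact: expR_gt0.
apply: (@le_trans _ _ (B * ((E * (1 + M * k) - 1) / M))).
  have -> : B * ((E * (1 + M * k) - 1) / M) =
      (1 + M * k) * (B * ((E - 1) / M)) + B * k by field; rewrite gt_eqF.
  by rewrite lerD2r ler_wpM2l// addr_ge0.
rewrite ler_wpM2l// ler_pM2r ?invr_gt0// lerD2r ler_pM2l//.
Qed.

Lemma expR_error_ge0 M s : 0 < M -> 0 <= s -> 0 <= (expR (M * s) - 1) / M.
Proof.
move=> M0 s0; rewrite divr_ge0 ?(ltW M0)// subr_ge0 -[leLHS]expR0 ler_expR.
by rewrite mulr_ge0// ltW.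
Qed.

Lemma ler_expR_error M s t : 0 < M -> s <= t ->
  (expR (M * s) - 1) / M <= (expR (M * t) - 1) / M.
Proof.
by move=> M0 st; rewrite ler_pM2r ?invr_gt0// lerD2r ler_expR ler_pM2l.
Qed.

End OneStep.

Section GlobalError.
Variables (R : realType) (a b x0 y0 : R) (f : R -> R -> R) (y : R -> R).
Variables (h0 : R) (gamma : \bar R) (Phi : R -> R -> R -> R) (M N p : R).
Hypothesis x0_ab : a <= x0 <= b.
Hypothesis y_sol : is_msolution f a b x0 y0 y.
Hypothesis gamma_gt1 : (1 < gamma)%E.
Hypothesis Phi_gt0 :
  forall x u h, Gdomain y a b gamma h0 (x, u, h) -> 0 < Phi x u h.
Hypotheses (M_gt0 : 0 < M) (N_gt0 : 0 < N).
Hypothesis Phi_growth : forall x y1 y2 h,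
  Gdomain y a b gamma h0 (x, y1, h) -> Gdomain y a b gamma h0 (x, y2, h) ->
  mabs (Phi x y1 h / Phi x y2 h) <= mabs (y1 / y2) `^ M.
Hypothesis tau_bound :
  forall x h, a <= x <= b -> `|h| <= h0 -> a <= x + h <= b ->
  forall z, is_msolution f a b x (y x) z ->
  mabs (local_error f Phi z x (y x) h) <= expR (N * `|h| `^ p).

(** Assuming that the final bound stays below [gamma] serves finite and infinite [gamma] alike; how
    small the step must be is settled afterwards. *)
Lemma global_error_le (x : R) (n : nat) :
  a <= x <= b -> (0 < n)%N -> `|stepsize x0 x n| <= h0 ->
  let B := `|stepsize x0 x n| `^ p * N * ((expR (M * `|x - x0|) - 1) / M) in
  ((expR B)%:E <= gamma)%E ->
  mabs (global_error Phi y x0 y0 x n) <= expR B.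
Proof.
move=> xab n0; set h := stepsize x0 x n => hh0 B Bgamma.
have [yx0 yc yn0 yd] := y_sol.
have nn0 : n%:R != 0 :> R by rewrite pnatr_eq0 -lt0n.
have nh : n%:R * h = x - x0 by rewrite /h /stepsize; field.
have grid_ab i : (i <= n)%N -> a <= grid x0 h i <= b by exact: grid_itv.
rewrite /global_error -/h; clearbody h.
have ypos := same_sign_of_continuous_neq0 yc yn0.
have C0 : 0 <= `|h| `^ p * N by rewrite mulr_ge0 ?powR_ge0// ltW.
(* Positivity is carried along, since [mabs] is [expR] of the absolute logarithm only at positive
   arguments. *)
suff H i : (i <= n)%N -> let r := Defs.eta Phi x0 y0 h i / y (grid x0 h i) in
    0 < r /\ `|ln r| <= `|h| `^ p * N * ((expR (M * (i%:R * `|h|)) - 1) / M).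
  have [] := H n (leqnn n); rewrite gridE nh subrKC => r0 le_r.
  rewrite mabs_le_expR//; apply: le_trans le_r _.
  by rewrite -[X in X * `|h|]normr_nat -normrM nh.
elim: i => [|i IH] lein /=.
  rewrite -yx0 divff ?yn0// ln1 normr0; split=> //.
  by rewrite mulr_ge0// expR_error_ge0// mul0r.
have [r0 le_r] := IH (ltnW lein).
have tab := grid_ab i (ltnW lein).
have t'ab := grid_ab i.+1 lein.
move: r0 le_r tab t'ab => /=.
set t := grid x0 h i; set u := Defs.eta Phi x0 y0 h i => r0 le_r tab t'ab.
have Gy : Gdomain y a b gamma h0 (t, y t, h).
  split=> //=; first exact: yn0.
  by rewrite divff ?yn0// mabsE// ln1 normr0 expR0 ltW.
have Gu : Gdomain y a b gamma h0 (t, u, h).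
  split=> //=; first by apply: contraTneq r0 => ->; rewrite mul0r ltxx.
  (* The bound increases with [i], so the one at [n] controls all earlier ones and no iterate leaves
     the domain. *)
  apply: le_trans Bgamma; rewrite lee_fin mabs_le_expR//.
  apply: le_trans le_r _; rewrite ler_wpM2l// ler_expR_error//.
  by rewrite -nh normrM normr_nat ler_wpM2r// ler_nat ltnW.
have Pu0 := Phi_gt0 Gu; have Py0 := Phi_gt0 Gy.
have [|h1|h1|u'0 le_u'] :=
  one_step_log_error (M := M) (B := `|h| `^ p * N) (h := h) r0
    (ypos _ _ tab t'ab) Pu0 Py0.
(* In logarithms the growth condition is a Lipschitz condition with constant [M]. *)
- have := Phi_growth Gu Gy; rewrite [X in _ <= X `^ _]mabsE//.
  by rewrite /powR gt_eqF ?expR_gt0// expRK mabs_le_expR ?divr_gt0.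
- have y_sol_t : is_msolution f a b t (y t) y by split.
  have := tau_bound tab hh0 t'ab y_sol_t.
  rewrite /local_error /mratio (negbTE h1) [N * _]mulrC mabs_le_expR//.
  by apply: divr_gt0 => //; exact/powR_gt0/ypos.
- by rewrite h1 addr0.
split=> //; apply: le_trans le_u' _.
by apply: discrete_gronwall_step.
Qed.

End GlobalError.

Theorem theorem1 (R : realType) (a b x0 y0 : R) (f : R -> R -> R) (y : R -> R)
    (h0 : R) (gamma : \bar R) (Phi : R -> R -> R -> R) (M N p : R)
    (x0_ab : a <= x0 <= b)
    (f_diff : mdifferentiable2 f a b)
    (y_sol : is_msolution f a b x0 y0 y)
    (h0_gt0 : 0 < h0)
    (gamma_gt1 : (1 < gamma)%E)
    (Phi_cont : {within Gdomain y a b gamma h0,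
                   continuous (fun q : R * R * R => Phi q.1.1 q.1.2 q.2)})
    (Phi_gt0 : forall x u h, Gdomain y a b gamma h0 (x, u, h) -> 0 < Phi x u h)
    (M_gt0 : 0 < M) (N_gt0 : 0 < N) (p_gt0 : 0 < p)
    (Phi_growth : forall x y1 y2 h,
       Gdomain y a b gamma h0 (x, y1, h) -> Gdomain y a b gamma h0 (x, y2, h) ->
       mabs (Phi x y1 h / Phi x y2 h) <= mabs (y1 / y2) `^ M)
    (tau_bound : forall x h, a <= x <= b -> `|h| <= h0 -> a <= x + h <= b ->
       forall z, is_msolution f a b x (y x) z ->
       mabs (local_error f Phi z x (y x) h) <= expR (N * `|h| `^ p)) :
  (exists2 hbar : R, 0 < hbar <= h0 &
     global_error_bound Phi y a b x0 y0 M N p hbar) /\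
  (gamma = +oo%E -> global_error_bound Phi y a b x0 y0 M N p h0).
Proof.
have le_err := global_error_le x0_ab y_sol gamma_gt1 Phi_gt0 M_gt0 N_gt0
  Phi_growth tau_bound.
split; last by move=> gammaoo x n xab n0 hh0; apply: le_err; rewrite // gammaoo leey.
case: gamma gamma_gt1 le_err {Phi_cont Phi_gt0 Phi_growth} => [g||] //; last first.
  move=> _ le_err; exists h0; first by rewrite h0_gt0 lexx.
  by move=> x n xab n0 hh0; apply: le_err; rewrite // leey.
rewrite lte_fin => g1 le_err.
(* The constant [C] below dominates the growth factor for every [x], since [|x - x0| <= b - a];
   hence the step bound will not depend on [x]. *)
have ab : 0 <= b - a by rewrite subr_ge0; case/andP: x0_ab; exact: le_trans.
have C0 := expR_error_ge0 M_gt0 ab.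
set C := _ / M in C0.
have lng : 0 < ln g by rewrite ln_gt0.
(* The summand 1 keeps the divisor positive when a = b. *)
have D0 : 0 < N * C + 1 by rewrite ltr_wpDl// mulr_ge0// ltW.
(* Chosen so that [k] to the power [p], times [N * C + 1], equals [ln g], the largest exponent that
   [gamma] permits. *)
set k := (ln g / (N * C + 1)) `^ p^-1.
have k0 : 0 < k by rewrite powR_gt0// divr_gt0.
exists (Num.min h0 k); first by rewrite lt_min h0_gt0 k0 ge_min lexx.
move=> x n xab n0; rewrite le_min => /andP[hh0 hk].
apply: le_err => //; rewrite lee_fin -[leRHS](@lnK _ g) ?posrE ?(lt_trans ltr01)//
  ler_expR.
have hp : `|stepsize x0 x n| `^ p <= ln g / (N * C + 1).
  apply: (@le_trans _ _ (k `^ p)); first by rewrite ge0_ler_powR// ?nnegrE// ltW.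
  by rewrite -powRrM mulVf ?gt_eqF// powRr1// divr_ge0// ltW.
have xC : (expR (M * `|x - x0|) - 1) / M <= C.
  apply: ler_expR_error => //; case/andP: xab => ? ?; case/andP: x0_ab => ? ?.
  by rewrite ler_norml; apply/andP; split; lra.
rewrite -mulrA; apply: (@le_trans _ _ (ln g / (N * C + 1) * (N * C + 1))).
  apply: ler_pM; rewrite ?powR_ge0//.
    by rewrite mulr_ge0 ?(ltW N_gt0)// expR_error_ge0.
  by rewrite (le_trans (ler_wpM2l (ltW N_gt0) xC))// lerDl.
by rewrite divfK// gt_eqF.
Qed.
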